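(* If $P$ is a regular $l_1$-property, then $\mathrm{pre}(P)$ is also a regular $l_1$-property and $$\mathrm{reg}(\mathrm{pre}(P))\ \ge\ \mathrm{reg}(P).$$
   Context: Scalars are real. Properties of Banach spaces are identified with classes of Banach spaces. $S(X)$ denotes the unit sphere of $X$. For a set $\Gamma$, $l_1(\Gamma)$ is the usual space of absolutely summable real functions on $\Gamma$, and for a Banach space $X$, $l_\infty(\Gamma,X)$ is the space of bounded functions $x:\Gamma\to X$ with the sup-norm. Each $a\in S(l_1(\Gamma))$ is identified with the linear operator $a:l_\infty(\Gamma,X)\to X$, $a(x)=\sum_{\gamma\in\Gamma}a(\gamma)x(\gamma)$. Here $\mathrm{sign}\,t\in\{0,1,-1\}$ for real $t$. Index. For $A\subset S(l_1(\Gamma))$ and a Banach space $X$, the index $h(X,A)$ of $A$ in $X$ is the supremum of those $\delta$ for which there exists $x\in S(l_\infty(\Gamma,X))$ with $\inf_{a\in A}\|a(x)\|\ge\delta$. Regular $l_1$-property. A class $P$ of Banach spaces is a regular $l_1$-property if there exist a real number $\delta>0$, a set $\Gamma$ and a subset $A\subset S(l_1(\Gamma))$ satisfying: 1. $A$ consists of finitely non-zero vectors. 2. If $a_0\in A$, then $A$ contains all vectors $a\in S(l_1(\Gamma))$ for which $\mathrm{sign}\,a_0(\gamma)=\mathrm{sign}\,a(\gamma)$ for all $\gamma\in\Gamma$. 3. For a Banach space $X$ the following are equivalent: (a) $X\notin P$; (b) $h(X,A)>0$; (c) $h(X,A)\ge\delta$. The regular exponent $\mathrm{reg}(P)$ of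 such a class $P$ is the supremum of those $\delta>0$ for which there exist $\Gamma$ and $A\subset S(l_1(\Gamma))$ such that conditions 1, 2 and 3 are satisfied. Preclass. For a class $P$ of Banach spaces, the preclass $\mathrm{pre}(P)$ is the class of all Banach spaces $X$ whose dual $X^*$ belongs to $P$. *)

(* Defs.v *)
From HB Require Import structures.
From mathcomp Require Import all_boot all_order all_algebra.
From mathcomp Require Import all_classical all_reals all_analysis.
From mathcomp Require summability.

Set Implicit Arguments.
Unset Strict Implicit.
Unset Printing Implicit Defensive.

Import Order.TTheory GRing.Theory Num.Theory.
Import numFieldNormedType.Exports.

Local Open Scope classical_set_scope.
Local Open Scope ring_scope.

Section DualSpace.
Context (R : realType) (X : normedModType R).

Definition functional : {pred X -> R^o} :=
  [pred f : X -> R^o | `[< linear f /\ continuous f >]].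

Lemma functional_submod_closed : submod_closed functional.
Proof.
split=> [|a f g /asboolP[lf cf] /asboolP[lg cg]]; apply/asboolP; split.
- by move=> a x y; rewrite /= scaler0 addr0.
- by move=> x; exact: (cvg_cst (0 : R^o)).
- by move=> b x y; rewrite /= !fctE lf lg !scalerDr !scalerA (mulrC b a) addrACA.
- move=> x; apply: (@continuousD _ _ _ (fun x => a *: f x) g); last exact: cg.
  by apply: continuousZl_tmp; exact: cf.
Qed.

HB.instance Definition _ :=
  GRing.isSubmodClosed.Build R (X -> R^o) functional functional_submod_closed.

Record dual := Dual { dual_fun :> X -> R^o; _ : dual_fun \in functional }.

HB.instance Definition _ := [isSub for dual_fun].
HB.instance Definition _ := [Choice of dual by <:].
HB.instance Definition _ := [SubChoice_isSubLmodule of dual by <:].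

Definition dual_norm (f : dual) : R :=
  sup [set `|f x| | x in [set x : X | `|x| <= 1]].

Lemma dual_linear (f : dual) : linear f.
Proof. by case: f => f /= /asboolP[]. Qed.

Lemma dual_continuous (f : dual) : continuous f.
Proof. by case: f => f /= /asboolP[]. Qed.

Lemma dualZ (f : dual) a x : f (a *: x) = a * f x.
Proof.
have f0 : f 0 = 0.
  by have := dual_linear f (-1) 0 0; rewrite scaler0 addr0 scaleN1r addNr.
by have := dual_linear f a x 0; rewrite !addr0 f0 addr0.
Qed.

Lemma linear_has_ubound (f : X -> R^o) : linear f -> continuous f ->
  exists2 M, 0 <= M & forall x, `|f x| <= M * `|x|.
Proof.
move=> lf cf; pose g : {linear X -> R^o} := HB.pack f (GRing.isLinear.Build _ _ _ _ _ lf).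
have /linear_boundedP : bounded_near g (nbhs 0) by apply: continuous_linear_bounded; exact: cf.
move=> /pinfty_ex_gt0[M M0 Mf]; exists M => //; exact: ltW.
Qed.

Lemma dual_norm_ub (f : dual) : has_ubound [set `|f x| | x in [set x : X | `|x| <= 1]].
Proof.
have [M M0 Mf] := linear_has_ubound (dual_linear f) (@dual_continuous f).
exists M => _ [x /= x1 <-]; rewrite (le_trans (Mf x))//.
by rewrite -[leRHS]mulr1 ler_wpM2l.
Qed.

Lemma dual_norm_ge0 (f : dual) : 0 <= dual_norm f.
Proof.
have : `|f 0| <= dual_norm f.
  by apply: ub_le_sup; [exact: dual_norm_ub|exists 0 => //=; rewrite normr0].
exact: le_trans.
Qed.

Lemma dual_normP (f : dual) x : `|f x| <= dual_norm f * `|x|.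
Proof.
have [->|x0] := eqVneq x 0.
  by rewrite -(scale0r (0 : X)) dualZ mul0r normr0 mulr_ge0// dual_norm_ge0.
have nx : 0 < `|x| by rewrite normr_gt0.
rewrite -ler_pdivrMr//.
have -> : `|f x| / `|x| = `|f (`|x|^-1 *: x)|.
  by rewrite dualZ normrM normfV normr_id mulrC.
by apply: ub_le_sup; [exact: dual_norm_ub|exists (`|x|^-1 *: x) => //=; rewrite normfZV].
Qed.

Lemma dual_norm_le (f : dual) M :
  (forall x, `|x| <= 1 -> `|f x| <= M) -> dual_norm f <= M.
Proof.
move=> Mf; apply: ge_sup; last by move=> _ [x /= x1 <-]; exact: Mf.
by exists `|f 0|, 0 => //=; rewrite normr0.
Qed.

Lemma dual_normD f g : dual_norm (f + g) <= dual_norm f + dual_norm g.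
Proof.
apply: dual_norm_le => x x1; rewrite (le_trans (ler_normD _ _))// lerD//.
- by rewrite (le_trans (dual_normP f x))// -[leRHS]mulr1 ler_wpM2l// dual_norm_ge0.
- by rewrite (le_trans (dual_normP g x))// -[leRHS]mulr1 ler_wpM2l// dual_norm_ge0.
Qed.

Lemma dual_normZ_le a f : dual_norm (a *: f) <= `|a| * dual_norm f.
Proof.
apply: dual_norm_le => x x1.
rewrite [_ x](_ : _ = a * f x)// normrM ler_wpM2l//.
by rewrite (le_trans (dual_normP f x))// -[leRHS]mulr1 ler_wpM2l// dual_norm_ge0.
Qed.

Lemma dual_normZ a f : dual_norm (a *: f) = `|a| * dual_norm f.
Proof.
apply/eqP; rewrite eq_le dual_normZ_le/=.
have [->|a0] := eqVneq a 0; first by rewrite normr0 mul0r dual_norm_ge0.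
rewrite -ler_pdivlMl ?normr_gt0// -normfV.
by rewrite -[in leLHS](scale1r f) -(mulVf a0) -scalerA dual_normZ_le.
Qed.

Lemma dual_norm0_eq0 f : dual_norm f = 0 -> f = 0.
Proof.
move=> f0; apply/val_inj/funext => x; apply/normr0_eq0/eqP.
by rewrite eq_le normr_ge0 andbT (le_trans (dual_normP f x))// f0 mul0r.
Qed.

HB.instance Definition _ :=
  Lmodule_isNormed.Build R dual dual_normD dual_normZ dual_norm0_eq0.

Lemma dual_complete (F : set_system dual) : ProperFilter F -> cauchy F -> cvg F.
Proof.
move=> FF Fc.
have Fb (e : R) : 0 < e -> \forall f & g \near F,
    forall x, `|(f : dual) x - (g : dual) x| <= e * `|x|.
  move=> e0; have /cauchy_ballP/(_ _ e0) := Fc.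
  apply: filterS => -[f g] /= fg x.
  have := dual_normP (f - g) x; move/le_trans; apply.
  by rewrite ler_wpM2r//; move: fg; rewrite -ball_normE => /ltW.
have Fcx x : cvg ((fun f : dual => f x) @ F).
  apply/cauchy_cvgP/cauchy_ballP => e e0.
  have e1 : 0 < e / (`|x| + 1) by rewrite divr_gt0// ltr_wpDl.
  have [[A B] /= [FA FB] AB] := Fb _ e1.
  exists ((fun f : dual => f x) @` A, (fun f : dual => f x) @` B) => /=.
    by split; [apply: filterS FA => f ?; exists f|apply: filterS FB => f ?; exists f].
  move=> [_ _] /= [[f Af <-] [g Bg <-]]; rewrite -ball_normE/=.
  rewrite (le_lt_trans (AB (f, g) (conj Af Bg) x))// mulrAC ltr_pdivrMr.
    by rewrite ltr_pM2l// ltrDl.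
  by rewrite ltr_wpDl.
pose l x : R^o := lim ((fun f : dual => f x) @ F).
have ll : linear l.
  move=> a x y; apply/cvg_lim => //.
  rewrite (_ : (fun f : dual => f (a *: x + y)) = (fun f => a *: f x + f y)).
    by apply: (@cvgD _ R^o _ F _ (fun f : dual => a *: f x) (fun f : dual => f y));
      [|exact: Fcx];
      apply: (@cvgM _ _ F _ (fun=> a) (fun f : dual => f x) a);
      [exact: cvg_cst|exact: Fcx].
  by apply/funext => f; exact: dual_linear.
have lF (e : R) : 0 < e -> \forall f \near F, forall x, `|(f : dual) x - l x| <= e * `|x|.
  move=> e0; have := Fb _ e0 => -[[A B] /= [FA FB] AB].
  apply: filterS FA => f Af x.
  have cn : (fun g : dual => `|f x - g x|) @ F --> `|f x - l x|.
    by apply: cvg_norm; apply: cvgB; [exact: cvg_cst|exact: Fcx].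
  rewrite -(cvg_lim _ cn)//; apply: limr_le; first by apply/cvg_ex; eexists; exact: cn.
  by apply: filterS FB => g Bg; exact: (AB (f, g)).
have lc : continuous l.
  have /filter_ex[f fl] := lF 1 ltr01.
  pose L : {linear X -> R^o} := HB.pack l (GRing.isLinear.Build _ _ _ _ _ ll).
  apply: (@bounded_linear_continuous _ _ _ L); apply/linear_boundedP.
  apply: filterS (nbhs_pinfty_ge (num_real (dual_norm f + 1))) => r fr x.
  rewrite (@le_trans _ _ ((dual_norm f + 1) * `|x|))//; last by rewrite ler_wpM2r.
  rewrite /L/= -[l x](subKr (f x)) (le_trans (ler_normB _ _))// mulrDl lerD//.
  exact: dual_normP.
have lP : l \in functional by apply/asboolP.
apply/cvg_ex; exists (Dual lP); apply/cvgrPdist_le => e e0.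
apply: filterS (lF e e0) => f fl; rewrite distrC; apply: dual_norm_le => x x1.
by rewrite (le_trans (fl x))// -[leRHS]mulr1 ler_wpM2l// ltW.
Qed.

HB.instance Definition _ := Uniform_isComplete.Build dual dual_complete.

End DualSpace.

Section Index.
Context (R : realType).

Definition l1_sphere (G : choiceType) : set (G -> R) :=
  [set a | \esum_(g in [set: G]) `|a g|%:E = 1%E].

Definition linf_sphere (G : choiceType) (X : normedModType R) : set (G -> X) :=
  [set x | bounded_fun x /\ sup [set `|x g| | g in [set: G]] = 1].

(* The sum is the limit of the finite partial sums along the directed set of
   finite subsets of [G]. *)
Definition l1_act (G : choiceType) (X : normedModType R)
  (a : G -> R) (x : G -> X) : X := summability.sum (fun g => a g *: x g).

(* Suprema and infima are taken in the extended reals; for [A] empty the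
   infimum is +oo, and if the sphere of l_oo(G, X) is empty the index is -oo. *)
Definition l1_index (G : choiceType) (X : normedModType R) (A : set (G -> R)) :
  \bar R :=
  ereal_sup [set d%:E | d in [set d : R | exists2 x : G -> X,
    linf_sphere x & (d%:E <= ereal_inf [set `|l1_act a x|%:E | a in A])%E]].

End Index.

Section RegularProperties.
Context (R : realType).

Definition regular_for (P : completeNormedModType R -> Prop) (d : R)
    (G : choiceType) (A : set (G -> R)) : Prop :=
  [/\ A `<=` @l1_sphere R G,
      forall a, A a -> finite_set [set g | a g != 0],
      forall a0 a, A a0 -> l1_sphere a ->
        (forall g, Num.sg (a0 g) = Num.sg (a g)) -> A a
    & forall X : completeNormedModType R,
        [<-> ~ P X; (0 < l1_index X A)%E; (d%:E <= l1_index X A)%E]].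

Definition regular_constants (P : completeNormedModType R -> Prop) : set R :=
  [set d | 0 < d /\
    exists (G : choiceType) (A : set (G -> R)), regular_for P d A].

Definition regular_l1_property (P : completeNormedModType R -> Prop) : Prop :=
  exists d, regular_constants P d.

(* Extended-real valued: the exponent is +oo e.g. for the class of all Banach
   spaces, where [A] can be taken empty over an empty [G]. *)
Definition reg (P : completeNormedModType R -> Prop) : \bar R :=
  ereal_sup [set d%:E | d in regular_constants P].

Definition preclass (P : completeNormedModType R -> Prop) :
  completeNormedModType R -> Prop := fun X => P (dual X).

End RegularProperties.

(* Main.v *)
(* Let A be the family defining P. A function f : G -> X^* in the unit ball
   satisfies |a(f)| >= c for all a in A iff, up to an arbitrarily small loss
   in c, there are points x_a in the unit ball of X, one for each a in A, with
   sign(a(g)) f_g(x_a) >= c whenever a(g) <> 0: one direction is a minimax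
   (Helly) argument for the finitely many functionals in the support of a, the
   other is immediate. By Hahn-Banach, f can in turn be recovered from the x_a
   iff, for every g, the convex combinations of the vectors sign(a(g)) x_a have
   norm at least c. This last condition is a lower bound for |b(x)| over a
   sign-closed family B of finitely non-zero elements of the sphere of l_1(A),
   so h(X, B) = h(X^*, A) and B witnesses pre(P) with the same constant. (If A
   is empty, the empty family over the same G is used instead.)

   Both separation arguments follow from one form of the Mazur-Orlicz theorem,
   proved by applying Zorn's lemma to sublinear functionals instead of to
   partially defined linear ones: a minimal sublinear functional is linear. *)

From HB Require Import structures.
Require Import Defs.
From mathcomp Require Import all_boot all_order all_algebra.
From mathcomp Require Import all_classical all_reals all_analysis.
From mathcomp Require Import finmap lra.
From mathcomp Require summability.

Set Implicit Arguments.
Unset Strict Implicit.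
Unset Printing Implicit Defensive.

Import Order.TTheory GRing.Theory Num.Theory.
Import numFieldNormedType.Exports.

Local Open Scope classical_set_scope.
Local Open Scope ring_scope.

(** * The Mazur-Orlicz theorem *)

Section MazurOrlicz.
Context (R : realType) (V : lmodType R).
Implicit Types (p q : V -> R) (C : V -> R -> Prop).

Definition sublinear p :=
  (forall x y, p (x + y) <= p x + p y) /\
  (forall t x, 0 <= t -> p (t *: x) <= t * p x).

Lemma sublinear0 p : sublinear p -> p 0 = 0.
Proof.
move=> [pD pZ].
have := pZ 0 0 (lexx _); rewrite scale0r mul0r => p0.
by have := pD 0 0; rewrite addr0 => p1; lra.
Qed.

Lemma sublinearZ p t x : sublinear p -> 0 <= t -> p (t *: x) = t * p x.
Proof.
move=> hp; rewrite le0r => /predU1P[->|t0].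
  by rewrite scale0r mul0r sublinear0.
apply/eqP; rewrite eq_le (hp.2 _ _ (ltW t0))/= -ler_pdivlMl//.
have := hp.2 t^-1 (t *: x); rewrite scalerA mulVf ?gt_eqF// scale1r.
by apply; rewrite invr_ge0 ltW.
Qed.

Lemma sublinear_geN p x : sublinear p -> - p (- x) <= p x.
Proof.
by move=> hp; have := hp.1 x (- x); rewrite subrr (sublinear0 hp) => ?; lra.
Qed.

(** A cone in [V * R] written as a relation: [C z s] will be the demand that a functional take at
    least the value [s] at [z]. *)
Definition convex_cone C :=
  [/\ C 0 0,
      forall x y s t, C x s -> C y t -> C (x + y) (s + t)
    & forall x s t, 0 <= t -> C x s -> C (t *: x) (t * s)].

Section ConeInfimum.
Variables (p : V -> R) (C : V -> R -> Prop).
Hypotheses (hp : sublinear p) (hC : convex_cone C)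
  (pC : forall z s, C z s -> s <= p z).

Definition cone_values x : set R :=
  [set r | exists z s, C z s /\ r = p (x + z) - s].

(** The infimum builds the demands of [C] into [p]: a linear functional below [cone_inf] is below
    [p], and its values at [- z] give the lower bounds required by [C]. *)
Definition cone_inf x : R := inf (cone_values x).

Lemma cone_values_lbound x : lbound (cone_values x) (- p (- x)).
Proof.
move=> _ [z [s [Czs ->]]].
have := hp.1 (x + z) (- x); rewrite addrAC subrr add0r.
by have := pC Czs => ? ?; lra.
Qed.

Lemma cone_inf_le x z s : C z s -> cone_inf x <= p (x + z) - s.
Proof.
move=> Czs; apply: ge_inf; last by exists z, s.
by exists (- p (- x)); exact: cone_values_lbound.
Qed.

Lemma cone_inf_ge x m :
  (forall z s, C z s -> m <= p (x + z) - s) -> m <= cone_inf x.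
Proof.
move=> h; apply: lb_le_inf; last by move=> _ [z [s [Czs ->]]]; exact: h.
by exists (p (x + 0) - 0), 0, 0; split=> //; case: hC.
Qed.

Lemma cone_inf_le_self x : cone_inf x <= p x.
Proof. by case: hC => /(cone_inf_le x); rewrite addr0 subr0. Qed.

Lemma cone_infN z s : C z s -> cone_inf (- z) <= - s.
Proof.
by move=> /(cone_inf_le (- z)); rewrite addNr (sublinear0 hp) sub0r.
Qed.

Lemma cone_inf_sublinear : sublinear cone_inf.
Proof.
have [C0 CD CZ] := hC; split=> [x y|t x].
  rewrite -lerBlDr; apply: cone_inf_ge => z s Czs.
  rewrite lerBlDl -lerBlDr; apply: cone_inf_ge => w r Cwr.
  have := cone_inf_le (x + y) (CD _ _ _ _ Czs Cwr).
  by have := hp.1 (x + z) (y + w); rewrite addrACA => ? ?; lra.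
rewrite le0r => /predU1P[->|t0].
  rewrite scale0r mul0r.
  by have := cone_inf_le_self 0; rewrite (sublinear0 hp).
rewrite -ler_pdivrMl//; apply: cone_inf_ge => z s Czs.
rewrite ler_pdivrMl// mulrBr -(sublinearZ _ hp (ltW t0)) scalerDr.
exact: cone_inf_le (CZ _ _ _ (ltW t0) Czs).
Qed.

End ConeInfimum.

(** Zorn's lemma for the reversed pointwise order; a nonempty chain is bounded by its pointwise
    infimum. *)
Lemma minimal_sublinear p : sublinear p ->
  exists2 q, sublinear q /\ (forall x, q x <= p x) &
    forall r, sublinear r -> (forall x, r x <= q x) -> r = q.
Proof.
move=> hp; pose T := {q : V -> R | sublinear q /\ forall x, q x <= p x}.
pose below (s t : T) := `[< forall x, sval t x <= sval s x >].
have [||||[q [hq qp]] qmin] := @Zorn T below; last first.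
- exists q => // r hr rq.
  have hrp : sublinear r /\ forall x, r x <= p x.
    by split=> // x; exact: le_trans (rq x) (qp x).
  by have /(congr1 sval) := qmin (exist _ r hrp) (asboolT rq).
- move=> A Atot; have [[a0 Aa0]|A0] := pselect (A !=set0); last first.
    exists (exist _ p (conj hp (fun x => lexx _))) => s As.
    by exfalso; apply: A0; exists s.
  pose E x := [set sval a x | a in A].
  pose q x := inf (E x).
  have qle a x : A a -> q x <= sval a x.
    move=> Aa; apply: ge_inf; last by exists a.
    exists (- p (- x)) => _ [b _ <-].
    rewrite (le_trans _ (sublinear_geN x (svalP b).1))// lerN2.
    exact: (svalP b).2.
  have qge x m : (forall a, A a -> m <= sval a x) -> m <= q x.
    move=> h; apply: lb_le_inf; first by exists (sval a0 x), a0.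
    by move=> _ [a Aa <-]; exact: h.
  have hq : sublinear q.
    split=> [x y|t x].
      rewrite -lerBlDr; apply: (qge) => a Aa.
      rewrite lerBlDl -lerBlDr; apply: (qge) => b Ab; rewrite lerBlDl.
      (* Of two members of the chain the smaller serves for both [x] and [y], so the infimum is
         subadditive. *)
      have [/asboolP ab|/asboolP ba] := Atot a b Aa Ab.
        rewrite (le_trans (qle b _ Ab))// (le_trans ((svalP b).1.1 _ _))//.
        by rewrite lerD2r.
      rewrite (le_trans (qle a _ Aa))// (le_trans ((svalP a).1.1 _ _))//.
      by rewrite lerD2l.
    rewrite le0r => /predU1P[->|t0].
      rewrite scale0r mul0r (le_trans (qle a0 _ Aa0))//.
      by rewrite (sublinear0 (svalP a0).1).
    rewrite -ler_pdivrMl//; apply: (qge) => a Aa; rewrite ler_pdivrMl//.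
    by rewrite (le_trans (qle a _ Aa))// (svalP a).1.2// ltW.
  have qp x : q x <= p x by rewrite (le_trans (qle a0 x Aa0))// (svalP a0).2.
  exists (exist _ q (conj hq qp)) => s As; apply/asboolP => x.
  exact: qle.
- move=> [s hs] [t ht] /asboolP st /asboolP ts.
  by apply/eq_exist/funext => x; apply/eqP; rewrite eq_le (st x) (ts x).
- move=> r s t /asboolP rs /asboolP st; apply/asboolP => x.
  exact: le_trans (st x) (rs x).
- by move=> t; apply/asboolP.
Qed.

(** Lowering [q] along the ray through [y], with the demands [t * q y] at [t *: y], leaves it
    unchanged by minimality. Hence [q (- y) <= - q y], so [q] is odd, and odd sublinear maps are
    linear. *)
Lemma minimal_sublinear_linear q : sublinear q ->
  (forall r, sublinear r -> (forall x, r x <= q x) -> r = q) ->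
  linear (q : V -> R^o).
Proof.
move=> hq qmin.
have qN y : q (- y) = - q y.
  apply/eqP; rewrite eq_le; apply/andP; split; last first.
    by have := sublinear_geN (- y) hq; rewrite opprK.
  pose C z s := exists2 t, 0 <= t & z = t *: y /\ s = t * q y.
  have hC : convex_cone C.
    split.
    - by exists 0; rewrite ?scale0r ?mul0r.
    - move=> _ _ _ _ [t t0 [-> ->]] [u u0 [-> ->]].
      by exists (t + u); rewrite ?addr_ge0// scalerDl mulrDl.
    - move=> _ _ u u0 [t t0 [-> ->]].
      by exists (u * t); rewrite ?mulr_ge0// scalerA mulrA.
  have qC z s : C z s -> s <= q z.
    by move=> [t t0 [-> ->]]; rewrite (sublinearZ _ hq).
  rewrite -(qmin _ (cone_inf_sublinear hq hC qC) (cone_inf_le_self hq hC qC)).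
  rewrite [leRHS](_ : _ = - q y); last first.
    by rewrite (qmin _ (cone_inf_sublinear hq hC qC) (cone_inf_le_self hq hC qC)).
  by apply: cone_infN => //; exists 1; rewrite ?scale1r ?mul1r.
have qD x y : q (x + y) = q x + q y.
  apply/eqP; rewrite eq_le (hq.1 x y)/=.
  by have := hq.1 (- x) (- y); rewrite -opprD !qN => ?; lra.
move=> a x y; rewrite qD; congr (_ + _).
have [a0|a0] := leP 0 a; first by rewrite (sublinearZ _ hq).
rewrite -[LHS]opprK -qN -scaleNr (sublinearZ _ hq) ?oppr_ge0 ?ltW//.
by rewrite mulNr opprK.
Qed.

(* Applying this to the cone generated by a convex set [K] at the constant
   height [inf_K p] gives the usual Mazur-Orlicz theorem. *)
Theorem mazur_orlicz p C : sublinear p -> convex_cone C ->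
  (forall z s, C z s -> s <= p z) ->
  exists f : V -> R^o, [/\ linear f, forall x, f x <= p x
    & forall z s, C z s -> s <= f z].
Proof.
move=> hp hC pC.
have [q [hq qle] qmin] := minimal_sublinear (cone_inf_sublinear hp hC pC).
have ql := minimal_sublinear_linear hq qmin.
exists q; split=> // [x|z s Czs].
  exact: le_trans (qle x) (cone_inf_le_self hp hC pC x).
have := le_trans (qle _) (cone_infN hp pC Czs).
by have := sublinear_geN (- z) hq; rewrite opprK => ? ?; lra.
Qed.

End MazurOrlicz.

(** * Hahn-Banach separation and Helly's theorem *)

Section Duality.
Context (R : realType) (X : normedModType R).

Lemma norm_sublinear : sublinear (fun x : X => `|x|).
Proof.
by split=> [x y|t x t0]; [exact: ler_normD|rewrite normrZ ger0_norm].
Qed.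

Lemma dual0 (f : dual X) : f 0 = 0.
Proof. by rewrite -(scale0r (0 : X)) dualZ mul0r. Qed.

Lemma dual_sumE (I : Type) (r : seq I) (P : pred I) (F : I -> dual X) x :
  (\sum_(i <- r | P i) F i) x = \sum_(i <- r | P i) F i x.
Proof. exact: (big_morph (fun f : dual X => f x)). Qed.

Lemma le_dual_norm (f : dual X) x : `|x| <= 1 -> f x <= `|f|.
Proof.
move=> x1; rewrite (le_trans (ler_norm _))// (le_trans (dual_normP f x))//.
by rewrite ler_piMr// dual_norm_ge0.
Qed.

Lemma dual_sumr (I : Type) (r : seq I) (w : I -> R) (x : I -> X) (f : dual X) :
  f (\sum_(i <- r) w i *: x i) = \sum_(i <- r) w i * f (x i).
Proof.
elim: r => [|i r IHr]; first by rewrite !big_nil dual0.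
by rewrite !big_cons -IHr; exact: dual_linear.
Qed.

Lemma dual_le (f : dual X) x : `|f| <= 1 -> `|x| <= 1 -> f x <= 1.
Proof.
by move=> f1 x1; rewrite (le_trans (le_dual_norm f x1)).
Qed.

Lemma dual_le_norm (f : dual X) x : `|f| <= 1 -> f x <= `|x|.
Proof.
move=> f1; rewrite (le_trans (ler_norm _))// (le_trans (dual_normP f x))//.
by rewrite ler_piMl.
Qed.

(** Mazur-Orlicz below the norm: the bound [f x <= |x|] at both [x] and [- x] gives continuity and
    dual norm at most 1. *)
Lemma cone_functional (C : X -> R -> Prop) : convex_cone C ->
  (forall z s, C z s -> s <= `|z|) ->
  exists2 f : dual X, `|f| <= 1 & forall z s, C z s -> s <= f z.
Proof.
move=> hC CN.
have [f [fl fN fC]] := mazur_orlicz norm_sublinear hC CN.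
pose L : {linear X -> R^o} := HB.pack f (GRing.isLinear.Build _ _ _ _ _ fl).
have fabs x : `|f x| <= `|x|.
  rewrite ler_norml fN andbT lerNl -normrN.
  by rewrite (le_trans _ (fN _))// [f (- x)](linearN L).
have fc : continuous f.
  apply: (@bounded_linear_continuous _ _ _ L); apply/linear_boundedP.
  apply: filterS (nbhs_pinfty_ge (num_real (1 : R))) => r r1 x.
  by rewrite (le_trans (fabs x))// ler_peMl.
have fP : f \in @functional R X by apply/asboolP.
exists (Dual fP) => //.
by apply: dual_norm_le => x; exact: le_trans (fabs x).
Qed.

Lemma norming_functional (x : X) : x != 0 -> exists f : dual X, f x != 0.
Proof.
move=> x0; pose C z s := exists2 t, 0 <= t & z = t *: x /\ s = t * `|x|.
have [|z s [t t0 [-> ->]]|f _ fC] := @cone_functional C.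
- split.
  + by exists 0; rewrite ?scale0r ?mul0r.
  + move=> _ _ _ _ [t t0 [-> ->]] [u u0 [-> ->]].
    by exists (t + u); rewrite ?addr_ge0// scalerDl mulrDl.
  + move=> _ _ u u0 [t t0 [-> ->]].
    by exists (u * t); rewrite ?mulr_ge0// scalerA mulrA.
- by rewrite normrZ ger0_norm.
- exists f; rewrite gt_eqF// (lt_le_trans _ (fC x `|x| _)) ?normr_gt0//.
  by exists 1; rewrite ?scale1r ?mul1r.
Qed.

Section Max.
Context (I : finType) (i0 : I).

(** The entry at [i0] serves as the default of the big maximum, so that no foreign value such as 0
    enters. *)
Definition fmax (v : I -> R^o) : R := \big[Order.max/v i0]_i v i.

Lemma le_fmax v i : v i <= fmax v.
Proof. exact: Order.TotalTheory.le_bigmax. Qed.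

Lemma fmax_le v m : (forall i, v i <= m) -> fmax v <= m.
Proof. by move=> vm; apply/Order.TotalTheory.bigmax_leP; split. Qed.

Lemma fmax_sublinear : sublinear (fmax : (I -> R^o) -> R).
Proof.
split=> [v w|t v t0]; apply: fmax_le => i; first by rewrite lerD// le_fmax.
by rewrite [leLHS](_ : _ = t * v i)// ler_wpM2l// le_fmax.
Qed.

(** The weights are the values of [f] at the unit vectors. Domination at [- e i] makes them
    nonnegative; at the constants 1 and -1 it makes their sum 1. *)
Lemma fmax_dominated (f : (I -> R^o) -> R^o) : linear f ->
  (forall v, f v <= fmax v) ->
  exists t : I -> R, [/\ forall i, 0 <= t i, \sum_i t i = 1
    & forall v, f v = \sum_i t i * v i].
Proof.
move=> fl fm.
pose L : {linear (I -> R^o) -> R^o} :=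
  HB.pack f (GRing.isLinear.Build _ _ _ _ _ fl).
pose e i : I -> R^o := fun j => (i == j)%:R.
have fN v : f (- v) = - f v by rewrite [f (- v)](linearN L).
have fE v : f v = \sum_i f (e i) * v i.
  have -> : f v = f (\sum_i v i *: e i).
    congr f; apply/funext => j; rewrite fct_sumE (bigD1 j)//= big1.
      by rewrite addr0 [RHS](_ : _ = v j * (j == j)%:R)// eqxx mulr1.
    by move=> i ij; rewrite [LHS](_ : _ = v i * (i == j)%:R)// (negbTE ij) mulr0.
  rewrite [f _](linear_sum L); apply: eq_bigr => i _.
  by rewrite [LHS](linearZ_LR L) [LHS]mulrC.
exists (fun i => f (e i)); split=> //.
- move=> i; rewrite -oppr_le0 -fN (le_trans (fm _))//.
  by apply: fmax_le => j; rewrite [leLHS](_ : _ = - e i j)// oppr_le0 ler0n.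
- have -> : \sum_i f (e i) = f (fun=> 1).
    by rewrite fE; apply: eq_bigr => i _ /=; rewrite mulr1.
  apply/eqP; rewrite eq_le (le_trans (fm _)) ?fmax_le//=.
  rewrite -lerN2 -fN (le_trans (fm _))//.
  by apply: fmax_le => j.
Qed.

End Max.

(* If no such [x] exists, Mazur-Orlicz for the maximum functional on [I -> R]
   and the convex set of the [- F(x)], [|x| <= 1], yields a convex combination
   of the [F i] of norm at most [c'] < [c]. Its weights may vanish, so it is
   perturbed towards the strictly positive weights [a]. *)
Lemma helly (I : finType) (i0 : I) (F : I -> dual X) (a : I -> R) (c c' : R) :
  (forall i, `|F i| <= 1) -> (forall i, 0 < a i) -> \sum_i a i = 1 ->
  (forall t : I -> R, (forall i, 0 < t i) -> \sum_i t i = 1 ->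
    c <= `|\sum_i t i *: F i|) ->
  0 <= c' -> c' < c ->
  exists2 x : X, `|x| <= 1 & forall i, c' <= F i x.
Proof.
move=> F1 a0 a1 Fc c'0 c'c; apply: contrapT => nx.
have small x : `|x| <= 1 -> exists i, F i x < c'.
  move=> x1; apply: contrapT => h; apply: nx; exists x => // i.
  by rewrite leNgt; apply/negP => hi; apply: h; exists i.
(* The homogeneous form of the set of the [- F(x)] at height [- c']; by the triangle inequality it
   is closed under addition, because [0 <= c']. *)
pose C (z : I -> R^o) s := exists2 x : X, z = (fun i => - F i x) & s <= - c' * `|x|.
have hC : convex_cone C.
  split.
  - exists 0; last by rewrite normr0 mulr0.
    by apply/funext => i; rewrite dual0 oppr0.
  - move=> _ _ s t [x -> hs] [y -> ht]; exists (x + y).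
      apply/funext => i; have := dual_linear (F i) 1 x y.
      by rewrite !scale1r => ->; rewrite opprD.
    rewrite !mulNr in hs ht *.
    have := ler_wpM2l c'0 (ler_normD x y); rewrite mulrDr => ?; lra.
  - move=> _ s t t0 [x -> hs]; exists (t *: x).
      by apply/funext => i; rewrite dualZ [LHS]mulrN.
    by rewrite normrZ ger0_norm// mulrCA ler_wpM2l.
have Cm z s : C z s -> s <= fmax i0 z.
  move=> [x -> hs]; apply: (le_trans hs).
  have [->|x0] := eqVneq x 0.
    rewrite normr0 mulr0 (le_trans _ (le_fmax _ _ i0))//.
    by rewrite dual0 oppr0.
  have nx0 : 0 < `|x| by rewrite normr_gt0.
  have [|i] := small (`|x|^-1 *: x); first by rewrite normfZV.
  rewrite dualZ ltr_pdivrMl// => hi.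
  rewrite (le_trans _ (le_fmax _ _ i))// mulNr lerN2 mulrC.
  exact: ltW.
have [f [fl fm fC]] := mazur_orlicz (fmax_sublinear i0) hC Cm.
have [t [t0 t1 fE]] := fmax_dominated fl fm.
have tF x : `|x| <= 1 -> \sum_i t i * F i x <= c'.
  move=> x1; have := fC (fun i => - F i x) (- c' * `|x|).
  rewrite fE; under eq_bigr do rewrite mulrN.
  rewrite sumrN mulNr lerN2 => tx.
  rewrite (le_trans (tx _))//; first by exists x; rewrite // mulNr.
  by rewrite ler_piMr.
(* The first bound keeps [c' + e] below [c]; the second keeps [1 - e] positive, so that the
   perturbed weights are positive. *)
pose e := Num.min ((c - c') / 2) (1 / 2).
have e0 : 0 < e by rewrite lt_min; apply/andP; split; lra.
have [ec e1] : e <= (c - c') / 2 /\ e <= 1 / 2.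
  by split; rewrite /e ge_min lexx ?orbT.
have uc : c <= `|\sum_i ((1 - e) * t i + e * a i) *: F i|.
  apply: Fc => [i|].
    by rewrite ltr_wpDl ?mulr_gt0// mulr_ge0//; lra.
  by rewrite big_split/= -!mulr_sumr t1 a1; lra.
have ux x : `|x| <= 1 -> \sum_i ((1 - e) * t i + e * a i) * F i x <= c' + e.
  move=> x1; under eq_bigr do rewrite mulrDl -!mulrA.
  rewrite big_split/= -!mulr_sumr.
  have ax : \sum_i a i * F i x <= 1.
    by rewrite -a1 ler_sum// => i _; rewrite ler_piMr ?dual_le// ltW.
  have h1 : (1 - e) * (\sum_i t i * F i x) <= (1 - e) * c'.
    by rewrite ler_wpM2l ?tF//; lra.
  have h2 : e * (\sum_i a i * F i x) <= e * 1 by rewrite ler_wpM2l// ltW.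
  have h3 : 0 <= e * c' by rewrite mulr_ge0// ltW.
  lra.
have : `|\sum_i ((1 - e) * t i + e * a i) *: F i| <= c' + e.
  apply: dual_norm_le => x x1; rewrite dual_sumE.
  rewrite ler_norml ux// andbT lerNl.
  have := ux (- x); rewrite normrN => /(_ x1).
  rewrite -sumrN; apply: le_trans; rewrite le_eqVlt; apply/orP; left; apply/eqP.
  apply: eq_bigr => i _; rewrite -(scaleN1r x) dualZ.
  rewrite [X in - X = _](_ : _ = ((1 - e) * t i + e * a i) * F i x)//.
  by rewrite mulN1r mulrN.
by move=> ?; lra.
Qed.

End Duality.

(* Finitely supported elements of [l_1] as operators *)
#[local] Existing Instance summability.totally_filter.

Section FiniteSupport.
Context (R : realType) (G : choiceType).
Implicit Types (X : normedModType R) (a b : G -> R).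

Definition finitely_nonzero a := finite_set [set g | a g != 0].

Lemma finitely_nonzero_fset a : finitely_nonzero a ->
  exists S : {fset G}, forall g, (a g != 0) = (g \in S).
Proof.
move=> fa; exists (fset_set [set g | a g != 0]) => g.
by rewrite in_fset_set//; apply/idP/idP => [h|]; [exact/mem_set|move/set_mem].
Qed.

Lemma sub_finitely_nonzero a b : (forall g, b g != 0 -> a g != 0) ->
  finitely_nonzero a -> finitely_nonzero b.
Proof. by move=> ba; apply: sub_finite_set => g; exact: ba. Qed.

Lemma l1_actE X (S : {fset G}) a (x : G -> X) :
  (forall g, a g != 0 -> g \in S) -> l1_act a x = \sum_(g <- S) a g *: x g.
Proof.
move=> aS; apply: lim_near_cst; first exact: norm_hausdorff.
have : summability.totally [set T | (S `<=` T)%fset] by exists S.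
apply: filterS => T /= ST; rewrite /summability.partial_sum.
rewrite -(big_seq_fsetE _ T xpredT (fun g => a g *: x g))/=.
apply/esym/big_fset_incl => // g _ gS.
have [->|/aS] := eqVneq (a g) 0; first by rewrite scale0r.
by rewrite (negbTE gS).
Qed.

Lemma l1_sphereE (S : {fset G}) a : (forall g, a g != 0 -> g \in S) ->
  l1_sphere a <-> \sum_(g <- S) `|a g| = 1.
Proof.
move=> aS; rewrite /l1_sphere/=.
have -> : \esum_(g in [set: G]) `|a g|%:E = (\sum_(g <- S) `|a g|)%:E.
  rewrite -sumEFin fsbig_seq// -esum_fset//.
  rewrite [RHS]esum_mkcond; apply: eq_esum => g _.
  case: ifPn => // /negP gS; have [->|/aS ?] := eqVneq (a g) 0.
    by rewrite normr0.
  by exfalso; apply: gS; exact/mem_set.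
by split=> [[]|->].
Qed.

Lemma l1_act_supportE X (S : {fset G}) a (x : G -> X) :
  (forall g, (a g != 0) = (g \in S)) -> l1_act a x = \sum_(g <- S) a g *: x g.
Proof. by move=> aS; apply: l1_actE => g; rewrite aS. Qed.

Lemma l1_act0 X (x : G -> X) : l1_act (fun=> 0) x = 0.
Proof. by rewrite (@l1_actE _ fset0) ?big_seq_fset0// => g; rewrite eqxx. Qed.

Lemma l1_actD X a b (x : G -> X) : finitely_nonzero a -> finitely_nonzero b ->
  l1_act (fun g => a g + b g) x = l1_act a x + l1_act b x.
Proof.
move=> /finitely_nonzero_fset[S aS] /finitely_nonzero_fset[T bT].
have aST g : a g != 0 -> g \in (S `|` T)%fset by rewrite aS inE => ->.
have bST g : b g != 0 -> g \in (S `|` T)%fset by rewrite bT inE orbC => ->.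
rewrite !(@l1_actE _ (S `|` T)%fset)// -?big_split/=.
  by apply: eq_bigr => g _; rewrite scalerDl.
move=> g; have [a0|/aST//] := eqVneq (a g) 0.
by rewrite a0 add0r => /bST.
Qed.

Lemma l1_actZ X t a (x : G -> X) : finitely_nonzero a ->
  l1_act (fun g => t * a g) x = t *: l1_act a x.
Proof.
move=> /finitely_nonzero_fset[S aS]; rewrite !(@l1_actE _ S) ?scaler_sumr.
- by apply: eq_bigr => g _; rewrite scalerA.
- by move=> g; rewrite aS.
- by move=> g; rewrite mulf_eq0 negb_or aS => /andP[].
Qed.

Lemma l1_act_scale X t a (x : G -> X) : finitely_nonzero a ->
  l1_act a (fun g => t *: x g) = t *: l1_act a x.
Proof.
move=> /finitely_nonzero_fset[S aS]; rewrite !(l1_act_supportE _ aS) scaler_sumr.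
by apply: eq_bigr => g _; rewrite !scalerA mulrC.
Qed.

Lemma l1_sphere_neq0 a : finitely_nonzero a -> l1_sphere a ->
  exists g, a g != 0.
Proof.
move=> /finitely_nonzero_fset[S aS].
rewrite (@l1_sphereE S); last by move=> g; rewrite aS.
move=> a1; apply: contrapT => h; move/eqP: a1; rewrite big_seq big1.
  by rewrite eq_sym oner_eq0.
by move=> g gS; exfalso; apply: h; exists g; rewrite aS.
Qed.

End FiniteSupport.

(** * The index in terms of families in the unit ball *)

Section Index.
Context (R : realType) (G : choiceType).
Implicit Types (X : normedModType R) (A : set (G -> R)).

(** A form of the index with the ball in place of the sphere and an attained bound in place of a
    supremum; a family in the ball can be chosen one coordinate at a time. *)
Definition ball_attains X A (c : R) := exists2 x : G -> X,
  forall g, `|x g| <= 1 & forall a, A a -> c <= `|l1_act a x|.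

Lemma linf_sphere_has_ubound X (x : G -> X) : linf_sphere x ->
  has_ubound [set `|x g| | g in [set: G]].
Proof.
move=> [/pinfty_ex_gt0[M _ xM] _]; exists M => _ [g _ <-].
exact: xM.
Qed.

Lemma linf_sphere_le1 X (x : G -> X) g : linf_sphere x -> `|x g| <= 1.
Proof.
move=> hx; have [_ <-] := hx.
by apply: ub_le_sup; [exact: linf_sphere_has_ubound|exists g].
Qed.

Lemma linf_sphere_neq0 X (x : G -> X) : linf_sphere x -> exists g, x g != 0.
Proof.
move=> [_ x1]; apply: contrapT => h.
have x0 g : x g = 0 by apply/eqP/negPn/negP => xg; apply: h; exists g.
have [[g _]|G0] := pselect ([set: G] !=set0).
  have : sup [set `|x g| | g in [set: G]] <= 0.
    apply: ge_sup; first by exists `|x g|, g.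
    by move=> _ [k _ <-]; rewrite x0 normr0.
  by rewrite x1 ler10.
move/eqP: x1; rewrite (_ : [set _ | _ in _] = set0) ?sup0 1?eq_sym ?oner_eq0//.
by rewrite -subset0 => r [g _ _]; apply: G0; exists g.
Qed.

(** The factor is the inverse of the sup-norm of [x], which is positive and at most 1; being at
    least 1, it preserves lower bounds on [|a(x)|]. *)
Lemma linf_sphere_normalize X (x : G -> X) g0 :
  (forall g, `|x g| <= 1) -> x g0 != 0 ->
  exists2 t : R, 1 <= t & linf_sphere (fun g => t *: x g).
Proof.
move=> x1 x0; set N := sup [set `|x g| | g in [set: G]].
have xN g : `|x g| <= N.
  by apply: ub_le_sup; [exists 1 => _ [k _ <-]|exists g].
have N0 : 0 < N by rewrite (lt_le_trans _ (xN g0))// normr_gt0.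
have N1 : N <= 1.
  by apply: ge_sup => [|_ [g _ <-]//]; exists `|x g0|, g0.
have yx g : `|N^-1 *: x g| = N^-1 * `|x g|.
  by rewrite normrZ gtr0_norm ?invr_gt0.
have y1 g : `|N^-1 *: x g| <= 1 by rewrite yx ler_pdivrMl// mulr1.
exists N^-1; first by rewrite invf_ge1.
split.
  apply: filterS (nbhs_pinfty_ge (num_real (1 : R))) => r r1 g _.
  exact: le_trans (y1 g) r1.
apply/eqP; rewrite eq_le; apply/andP; split.
  by apply: ge_sup => [|_ [g _ <-]//]; exists `|N^-1 *: x g0|, g0.
rewrite -[leLHS](mulVf (lt0r_neq0 N0)) ler_pdivrMl//.
apply: ge_sup; first by exists `|x g0|, g0.
move=> _ [g _ <-]; rewrite -ler_pdivrMl// -yx.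
by apply: ub_le_sup; [exists 1 => _ [k _ <-]|exists g].
Qed.

Lemma lt_index_ball_attains X A c :
  (c%:E < l1_index X A)%E -> ball_attains X A c.
Proof.
move=> /ereal_sup_gt[_ [d [x hx dA] <-]]; rewrite lte_fin => cd.
exists x => [g|a Aa]; first exact: linf_sphere_le1.
rewrite (le_trans (ltW cd))// -lee_fin (le_trans dA)//.
by apply: ereal_inf_lbound; exists a.
Qed.

(** Since [A] is nonempty and [c > 0], the family [x] is nonzero and can be normalized. *)
Lemma ball_attains_le_index X A c : A !=set0 ->
  (forall a, A a -> finitely_nonzero a) -> 0 < c ->
  ball_attains X A c -> (c%:E <= l1_index X A)%E.
Proof.
move=> [a0 Aa0] Af c0 [x x1 xc].
have [g0 xg0] : exists g, x g != 0.
  apply: contrapT => h; have := xc _ Aa0; rewrite leNgt => /negP; apply.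
  have [S aS] := finitely_nonzero_fset (Af _ Aa0).
  rewrite (l1_act_supportE _ aS) big1 ?normr0// => g _.
  have [->|xg] := eqVneq (x g) 0; first by rewrite scaler0.
  by exfalso; apply: h; exists g.
have [t t1 tx] := linf_sphere_normalize x1 xg0.
apply: ereal_sup_ubound; exists c => //; exists (fun g => t *: x g) => //.
apply/ereal_infP => _ [a Aa <-]; rewrite lee_fin l1_act_scale; last exact: Af.
rewrite normrZ ger0_norm; last exact: le_trans ler01 t1.
by rewrite (le_trans (xc _ Aa))// ler_peMl.
Qed.

End Index.

(** The supremum in the index absorbs the loss from [c] to [c']. Positivity transfers too, since a
    positive index is at least some positive real [d]. *)
Lemma index_transfer (R : realType) (X Y : normedModType R)
    (G H : choiceType) (A : set (G -> R)) (B : set (H -> R)) :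
  B !=set0 -> (forall b, B b -> finitely_nonzero b) ->
  (forall c c', 0 < c' -> c' < c -> ball_attains X A c -> ball_attains Y B c') ->
  ((0 < l1_index X A)%E -> (0 < l1_index Y B)%E) /\
  (forall d, 0 < d -> (d%:E <= l1_index X A)%E -> (d%:E <= l1_index Y B)%E).
Proof.
move=> B0 Bf AB.
have le_index d : 0 < d ->
    (d%:E <= l1_index X A)%E -> (d%:E <= l1_index Y B)%E.
  move=> d0 dX; apply/lee_subgt0Pr => e e0.
  (* The chain [d > d - e' / 2 > d - e' > 0] provides one strict gap below the index of [X] and one
     for the passage to [Y]. *)
  pose e' := Num.min e (d / 2).
  have e'0 : 0 < e' by rewrite lt_min e0/= divr_gt0.
  have [e'e e'd] : e' <= e /\ e' <= d / 2.
    by split; rewrite /e' ge_min lexx ?orbT.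
  have dX' : ((d - e' / 2)%:E < l1_index X A)%E.
    by rewrite (lt_le_trans _ dX)// lte_fin; lra.
  have dY : ball_attains Y B (d - e').
    by apply: AB (lt_index_ball_attains dX'); lra.
  have := ball_attains_le_index B0 Bf _ dY; rewrite -EFinB.
  move=> h; apply: le_trans (h _); last by lra.
  by rewrite lee_fin; lra.
split=> // /ereal_sup_gt[_ [d hd <-]] d0.
apply: (lt_le_trans d0); apply: le_index; first by rewrite -lte_fin.
by apply: ereal_sup_ubound; exists d.
Qed.

(** * The dual family and the two transfers *)

Section DualFamily.
Context (R : realType) (G : choiceType) (A : set (G -> R)).

(* The coordinates of [l_oo(G -> R, X)] at indices outside [A] play no role. *)
Definition dual_family : set ((G -> R) -> R) :=
  [set b | [/\ l1_sphere b, finitely_nonzero b &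
    exists g, forall a, b a != 0 -> A a /\ Num.sg (b a) = Num.sg (a g)]].

Hypotheses (A1 : A `<=` @l1_sphere R G)
  (Af : forall a, A a -> finitely_nonzero a)
  (Asg : forall a0 a, A a0 -> l1_sphere a ->
    (forall g, Num.sg (a0 g) = Num.sg (a g)) -> A a).

Lemma dual_family_sg b0 b : dual_family b0 -> l1_sphere b ->
  (forall a, Num.sg (b0 a) = Num.sg (b a)) -> dual_family b.
Proof.
move=> [_ b0f [g b0g]] b1 sb.
have b_neq0 a : b a != 0 -> b0 a != 0 by rewrite -sgr_eq0 -sb sgr_eq0.
split=> //; first exact: sub_finitely_nonzero b0f.
by exists g => a ba; rewrite -sb; apply: b0g; exact: b_neq0.
Qed.

Lemma dual_family_neq0 : A !=set0 -> dual_family !=set0.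
Proof.
move=> [a Aa]; have [g ag] := l1_sphere_neq0 (Af Aa) (A1 Aa).
pose b a' : R := if a' == a then Num.sg (a g) else 0.
have bS a' : b a' != 0 -> a' \in [fset a]%fset.
  by rewrite /b in_fset1; case: ifP => //; rewrite eqxx.
exists b; split.
- apply/(l1_sphereE bS).
  by rewrite big_seq_fset1 /b eqxx normr_sg ag.
- apply: (@sub_finite_set _ _ [set a]); last exact: finite_set1.
  by move=> a' /bS; rewrite in_fset1 => /eqP.
- exists g => a'; rewrite /b; case: ifP => [/eqP -> _|]; last by rewrite eqxx.
  by split=> //; rewrite sgr_id.
Qed.

Lemma primal_to_dual_attains (X : normedModType R) (c : R) :
  ball_attains X dual_family c -> ball_attains (dual X) A c.
Proof.
move=> [x x1 xc].
have /choice[f fP] g : exists f : dual X, `|f| <= 1 /\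
    forall a, A a -> a g != 0 -> c <= Num.sg (a g) * f (x a).
  pose y (a : G -> R) : X := Num.sg (a g) *: x a.
  (* The cone generated by the [y a], for [a] in [A] with [g] in its support, at height [c]; [w]
     holds the weights. *)
  pose C z s := exists w : (G -> R) -> R,
    [/\ finitely_nonzero w, forall a, 0 <= w a,
      forall a, w a != 0 -> A a /\ a g != 0,
      z = l1_act w y & s <= c * l1_act w (fun=> 1 : R^o)].
  have hC : convex_cone C.
    split.
    - exists (fun=> 0); split=> //.
      + apply: (@sub_finite_set _ _ set0); last exact: finite_set0.
        by move=> a /=; rewrite eqxx.
      + by move=> a; rewrite eqxx.
      + by rewrite l1_act0.
      + by rewrite l1_act0 mulr0.
    - move=> _ _ s t [w [wf w0 wA -> hs]] [v [vf v0 vA -> ht]].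
      have wv a : w a + v a != 0 -> w a != 0 \/ v a != 0.
        by have [->|] := eqVneq (w a) 0; [rewrite add0r; right|left].
      exists (fun a => w a + v a); split.
      + apply: (@sub_finite_set _ _ ([set a | w a != 0] `|` [set a | v a != 0])).
          by move=> a /wv.
        by rewrite finite_setU.
      + by move=> a; rewrite addr_ge0.
      + by move=> a /wv[/wA|/vA].
      + by rewrite l1_actD.
      + by rewrite l1_actD// mulrDr lerD.
    - move=> _ s t t0 [w [wf w0 wA -> hs]].
      have tw a : t * w a != 0 -> w a != 0.
        by rewrite mulf_eq0 negb_or => /andP[].
      exists (fun a => t * w a); split.
      + exact: sub_finitely_nonzero wf.
      + by move=> a; rewrite mulr_ge0.
      + by move=> a /tw /wA.
      + by rewrite l1_actZ.
      + rewrite l1_actZ// [_ *: _](_ : _ = t * l1_act w (fun=> 1 : R^o))//.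
        by rewrite mulrCA ler_wpM2l.
  have CN z s : C z s -> s <= `|z|.
    move=> [w [wf w0 wA -> hs]]; apply: (le_trans hs).
    have [S wS] := finitely_nonzero_fset wf.
    have wE : l1_act w (fun=> 1 : R^o) = \sum_(a <- S) w a.
      by rewrite (l1_act_supportE _ wS); apply: eq_bigr => a _; rewrite [LHS]mulr1.
    rewrite wE; set N := \sum_(a <- S) w a.
    have : 0 <= N by rewrite sumr_ge0.
    rewrite le0r => /predU1P[->|N0]; first by rewrite mulr0.
    (* Normalizing the weights and restoring the signs gives a member of [dual_family], to which the
       hypothesis on [x] applies. *)
    pose b a := N^-1 * w a * Num.sg (a g).
    have bw a : b a != 0 -> w a != 0.
      by rewrite /b !mulf_eq0 !negb_or => /andP[/andP[]].
    have bS a : b a != 0 -> a \in S by rewrite -wS; exact: bw.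
    have b_dual : dual_family b.
      split.
      - apply/(l1_sphereE bS).
        rewrite -[RHS](mulVf (lt0r_neq0 N0)) mulr_sumr.
        rewrite big_seq [RHS]big_seq; apply: eq_bigr => a.
        rewrite -wS => /wA[_ ag]; rewrite /b !normrM normr_sg ag mulr1.
        by rewrite ger0_norm ?invr_ge0 ?ltW// ger0_norm.
      - exact: sub_finitely_nonzero wf.
      - exists g => a /bw wa; have [Aa ag] := wA _ wa; split=> //.
        rewrite /b sgrM sgr_id gtr0_sg ?mul1r// mulr_gt0 ?invr_gt0//.
        by rewrite lt0r wa w0.
    have bx : l1_act b x = N^-1 *: l1_act w y.
      rewrite (l1_actE _ bS) (l1_act_supportE _ wS) scaler_sumr.
      by apply: eq_bigr => a _; rewrite /b /y !scalerA.
    have := xc _ b_dual; rewrite bx normrZ gtr0_norm ?invr_gt0//.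
    by rewrite ler_pdivlMl// mulrC.
  have [f f1 fC] := cone_functional hC CN.
  exists f; split=> // a Aa ag; rewrite -dualZ; apply: fC.
  (* The point mass at [a] reads off the inequality for [y a]. *)
  pose w a' : R := (a' == a)%:R.
  have wS a' : w a' != 0 -> a' \in [fset a]%fset.
    by rewrite /w in_fset1 pnatr_eq0 eqb0 negbK.
  exists w; split.
  - apply: (@sub_finite_set _ _ [set a]); last exact: finite_set1.
    by move=> a' /wS; rewrite in_fset1 => /eqP.
  - by move=> a'; rewrite ler0n.
  - by move=> a' /wS; rewrite in_fset1 => /eqP ->.
  - by rewrite (l1_actE _ wS) big_seq_fset1 /w eqxx scale1r.
  - rewrite (l1_actE _ wS) big_seq_fset1 /w eqxx scale1r.
    by rewrite [leRHS]mulr1.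
exists f => [g|a Aa]; first by have [] := fP g.
have [S aS] := finitely_nonzero_fset (Af Aa).
have aS' g : a g != 0 -> g \in S by rewrite aS.
have /(l1_sphereE aS') a1 := A1 Aa.
(* The norm is tested at [x a], where the value is an average, with weights [|a g|], of numbers that
   are at least [c]. *)
rewrite (l1_actE _ aS') (le_trans _ (le_dual_norm _ (x1 a)))// dual_sumE.
rewrite -[leLHS]mulr1 -a1 mulr_sumr big_seq [leRHS]big_seq ler_sum// => g.
rewrite -aS => ag; have [_ /(_ _ Aa ag) cf] := fP g.
rewrite [leRHS](_ : _ = a g * f g (x a))// [X in _ <= X * _]numEsg mulrAC.
by rewrite ler_wpM2r.
Qed.

(** Helly's theorem is applied to each [a] separately: only the finitely many functionals on the
    support of [a] constrain [x a]. *)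
Lemma dual_to_primal_attains (X : normedModType R) (c c' : R) :
  0 < c' -> c' < c -> ball_attains (dual X) A c -> ball_attains X dual_family c'.
Proof.
move=> c'0 c'c [f f1 fc].
have /choice[x xP] a : exists x : X, `|x| <= 1 /\
    (A a -> forall g, a g != 0 -> c' <= Num.sg (a g) * f g x).
  have [Aa|nAa] := pselect (A a); last by exists 0; rewrite normr0.
  have [S aS] := finitely_nonzero_fset (Af Aa).
  have aS' g : a g != 0 -> g \in S by rewrite aS.
  have /(l1_sphereE aS') a1 := A1 Aa.
  have [g0 ag0] := l1_sphere_neq0 (Af Aa) (A1 Aa).
  have Sneq0 (i : S) : a (val i) != 0 by rewrite aS; exact: valP.
  pose F (i : S) : dual X := Num.sg (a (val i)) *: f (val i).
  have [||||||x x1 xF] :=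
      @helly _ _ S [` aS' _ ag0]%fset F (fun i => `|a (val i)|) c c'.
  - by move=> i; rewrite normrZ normr_sg Sneq0 mul1r.
  - by move=> i; rewrite normr_gt0.
  - by rewrite -a1 big_seq_fsetE.
  - move=> t t0 t1.
    (* A positive convex combination of the [F i] is the value at [f] of a member of [A]: [b] has
       the signs of [a] and the absolute values [t], so [Asg] applies. *)
    pose b g := if insub g is Some i then Num.sg (a g) * t (i : S) else 0.
    have bE (i : S) : b (val i) = Num.sg (a (val i)) * t i by rewrite /b valK.
    have bS g : b g != 0 -> g \in S.
      by rewrite /b; case: insubP => //= _; rewrite eqxx.
    have Ab : A b.
      apply: Asg Aa _ _.
        apply/(l1_sphereE bS); rewrite big_seq_fsetE/= -t1.
        apply: eq_bigr => i _.
        by rewrite bE normrM normr_sg Sneq0 mul1r gtr0_norm.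
      move=> g; rewrite /b; case: insubP => [i gS ig|].
        by rewrite sgrM sgr_id (gtr0_sg (t0 _)) mulr1.
      by rewrite -aS negbK => /eqP ->.
    rewrite (le_trans (fc _ Ab))// (l1_actE _ bS) big_seq_fsetE/=.
    rewrite le_eqVlt; apply/orP; left; apply/eqP; congr `|_|.
    by apply: eq_bigr => i _; rewrite bE /F scalerA mulrC.
  - exact: ltW.
  - exact: c'c.
  - exists x; split=> // _ g ag.
    exact: (xF [` aS' _ ag]%fset).
exists x => [a|b [b1 bf [g bg]]]; first by have [] := xP a.
have [S bS] := finitely_nonzero_fset bf.
have bS' a : b a != 0 -> a \in S by rewrite bS.
move: b1 => /(l1_sphereE bS') b1.
rewrite (l1_actE _ bS') (le_trans _ (dual_le_norm _ (f1 g)))// dual_sumr.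
rewrite -[leLHS]mulr1 -b1 mulr_sumr big_seq [leRHS]big_seq ler_sum// => a.
rewrite -bS => ba; have [Aa sab] := bg _ ba.
have ag : a g != 0 by rewrite -sgr_eq0 -sab sgr_eq0.
have [_ /(_ Aa _ ag) cf] := xP a.
by rewrite [X in _ <= X * _]numEsg sab mulrAC ler_wpM2r.
Qed.

End DualFamily.

(** * The empty family and the passage to the preclass *)

(** An infimum over the empty family is [+oo], so only nonemptiness of the sphere matters. A point
    of it yields a point of [G] and a nonzero vector of [X]. *)
Lemma index_set0_transfer (R : realType) (X Y : normedModType R)
    (G : choiceType) :
  ((exists x : X, x != 0) -> exists y : Y, y != 0) ->
  (0 < l1_index X (set0 : set (G -> R)))%E ->
  forall d : R, (d%:E <= l1_index Y (set0 : set (G -> R)))%E.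
Proof.
move=> XY /ereal_sup_gt[_ [_ [x hx _] _] _] d.
have [g xg] := linf_sphere_neq0 hx.
have [|y y0] := XY; first by exists (x g).
have [||t _ ty] := @linf_sphere_normalize _ _ Y (fun=> `|y|^-1 *: y) g.
- by move=> _; rewrite normfZV.
- by rewrite scaler_eq0 negb_or invr_eq0 normr_eq0 y0.
apply: ereal_sup_ubound; exists d => //; exists (fun=> t *: (`|y|^-1 *: y)) => //.
by apply/ereal_infP => _ [a []].
Qed.

Lemma dual_neq0 (R : realType) (X : normedModType R) :
  (exists f : dual X, f != 0) <-> exists x : X, x != 0.
Proof.
split=> [[f f0]|[x x0]].
  apply: contrapT => h; move/eqP: f0; apply; apply/val_inj/funext => x.
  have [->|x0] := eqVneq x 0; last by exfalso; apply: h; exists x.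
  exact: dual0.
have [f fx] := norming_functional x0.
by exists f; apply: contraNneq fx => ->.
Qed.

Lemma regular_for_preclass (R : realType)
    (P : completeNormedModType R -> Prop) (d : R) (G : choiceType)
    (A : set (G -> R)) : 0 < d -> regular_for P d A ->
  exists (H : choiceType) (B : set (H -> R)), regular_for (preclass P) d B.
Proof.
move=> d0 [A1 Af Asg AP].
have AP01 (X : completeNormedModType R) :
    ~ P X <-> (0 < l1_index X A)%E := all_iffP (AP X) 0 1.
have AP12 (X : completeNormedModType R) :
    (0 < l1_index X A)%E <-> (d%:E <= l1_index X A)%E := all_iffP (AP X) 1 2.
(* Two implications suffice: the equivalences for [A] at [dual X] close the cycle. *)
suff [H [B [B1 Bf Bsg [BA BAd]]]] : exists (H : choiceType) (B : set (H -> R)),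
    [/\ B `<=` @l1_sphere R H, forall b, B b -> finitely_nonzero b,
      forall b0 b, B b0 -> l1_sphere b ->
        (forall h, Num.sg (b0 h) = Num.sg (b h)) -> B b
    & (forall X : completeNormedModType R,
        (0 < l1_index X B)%E -> (0 < l1_index (dual X) A)%E) /\
      (forall X : completeNormedModType R, (d%:E <= l1_index (dual X) A)%E ->
        (d%:E <= l1_index X B)%E)].
  exists H, B; split=> // X; tfae.
  - by move=> /AP01/AP12/BAd; apply: lt_le_trans; rewrite lte_fin.
  - by move=> /BA/AP12/BAd.
  - move=> dB; apply/AP01/BA; apply: lt_le_trans dB.
    by rewrite lte_fin.
have [A0|A0] := pselect (A !=set0).
  exists (G -> R : choiceType), (dual_family A); split.
  - by move=> b [].
  - by move=> b [].
  - exact: dual_family_sg.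
  - split=> X.
      apply: (index_transfer A0 Af _).1 => c c' _ /ltW c'c.
      move=> /(primal_to_dual_attains A1 Af)[x x1 xc]; exists x => // a Aa.
      exact: le_trans c'c (xc _ Aa).
    apply: (index_transfer (dual_family_neq0 A1 Af A0) _ _).2 => //.
      by move=> b [].
    exact: dual_to_primal_attains.
(* Keeping [G] matters: over an empty [G] every index is [-oo], whereas [G -> R] is inhabited and
   would give nonzero spaces the index [+oo]. *)
have {A0}-> : A = set0 by rewrite -subset0 => a Aa; apply: A0; exists a.
exists G, set0; split=> //; split=> X.
  move=> h; apply: lt_le_trans (index_set0_transfer (dual_neq0 X).2 h d).
  by rewrite lte_fin.
move=> h; apply: (index_set0_transfer (dual_neq0 X).1).
by apply: lt_le_trans h; rewrite lte_fin.
Qed.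

Theorem theorem1 (R : realType) (P : completeNormedModType R -> Prop)
  (hP : regular_l1_property P) :
  regular_l1_property (preclass P) /\ (reg P <= reg (preclass P))%E.
Proof.
have constants_le : regular_constants P `<=` regular_constants (preclass P).
  by move=> d [d0 [G [A]]] /(regular_for_preclass d0).
split; first by have [d /constants_le] := hP; exists d.
by apply: ereal_sup_le => _ [d /constants_le hd <-]; exists d.
Qed.
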